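(* For an integer $n\ge 2$ let $\mathcal{N}_n(x)$ be the reduced Narayana polynomial of degree $n-1$, and let $\mathcal{P}_n(x)=\sum_{j=0}^{n-1}d_{n,j}x^j$ be the polynomial with coefficients $$d_{n,j}=\binom{n-1}{j}^2+\binom{n-1}{j+1}\binom{n-1}{j-1}.$$ Then, for every odd integer $n\ge 3$, $(x+1)\mathcal{P}_n(x)\prec\mathcal{N}_n(x)$, while for every even integer $n\ge 2$, $\mathcal{P}_n(x)\prec\dfrac{\mathcal{N}_n(x)}{x+1}$.
   Context: Narayana numbers: $c_{n,k}=\frac1n\binom{n}{k}\binom{n}{k-1}$ for $1\le k\le n$. The reduced Narayana polynomial is $\mathcal{N}_n(x)=\sum_{j=0}^{n-1}c_{n,j+1}x^j$. For even $n$, $x=-1$ is a zero of $\mathcal{N}_n$, so $\mathcal{N}_n(x)/(x+1)$ is a polynomial of degree $n-2$. Binomial coefficients $\binom{m}{r}$ with $r<0$ or $r>m$ are $0$. Notation $\prec$: for real polynomials $f$ of degree $m$ and $g$ of degree $m-1$, $f\prec g$ means that all zeros of $f$ and $g$ are real and distinct and, writing them in ascending order as $x_1<\dots<x_m$ (for $f$) and $y_1<\dots<y_{m-1}$ (for $g$), one has $x_1<y_1<x_2<y_2<\cdots<y_{m-1}<x_m$ (the condition is automatic if $m=1$). *)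

(* Defs.v *)
(* Mathematical Components; the real numbers are an arbitrary R : realType. *)
From HB Require Import structures.
From mathcomp Require Import all_boot all_order all_algebra.
From mathcomp Require Import reals.
Set Implicit Arguments.
Unset Strict Implicit.
Unset Printing Implicit Defensive.
Import Order.TTheory GRing.Theory Num.Theory.
Local Open Scope ring_scope.

Section Defs.
Variable R : realType.

(* The lower index is an integer because d_{n,0} involves binom(n-1, -1) = 0,
   which truncated natural subtraction would turn into binom(n-1, 0) = 1. *)
Definition binz (m : nat) (r : int) : nat :=
  match r with
  | Posz k => 'C(m, k)
  | Negz _ => 0%N
  end.

Definition narayana_num (n k : nat) : R :=
  (n%:R)^-1 * 'C(n, k)%:R * 'C(n, k.-1)%:R.

Definition narayana_poly (n : nat) : {poly R} :=
  \poly_(j < n) narayana_num n j.+1.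

Definition d_coef (n j : nat) : nat :=
  (binz n.-1 j%:Z ^ 2 + binz n.-1 (j%:Z + 1)%R * binz n.-1 (j%:Z - 1)%R)%N.

Definition P_poly (n : nat) : {poly R} :=
  \poly_(j < n) (d_coef n j)%:R.

(* All complex zeros of p, counted with multiplicity, are real and pairwise
   distinct, and xs lists them in ascending order: p splits over R with
   strictly increasing roots. *)
Definition simple_real_zeros (p : {poly R}) (xs : seq R) : Prop :=
  sorted <%R xs /\ p = lead_coef p *: \prod_(x <- xs) ('X - x%:P).

(* Zeros are indexed from 0, so x_{i+1} < y_{i+1} < x_{i+2} reads as below.
   The size of a polynomial is its degree plus 1. *)
Definition prec (f g : {poly R}) : Prop :=
  exists (m : nat) (xs ys : seq R),
    [/\ (0 < m)%N,
        size f = m.+1 /\ size g = m,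
        simple_real_zeros f xs,
        simple_real_zeros g ys
      & forall i : nat, (i < m.-1)%N -> xs`_i < ys`_i < xs`_i.+1].

(* For even n the Euclidean quotient N_n %/ ('X + 1) is exact. *)
Lemma dvdp_narayana_poly (n : nat) :
  ~~ odd n -> ('X + 1 : {poly R}) %| narayana_poly n.
Proof.
move=> n_even; have -> : 'X + 1 = 'X - (- 1)%:P :> {poly R}.
  by rewrite polyCN opprK.
rewrite dvdp_XsubCl rootE horner_poly.
set S := \sum_(i < n) _; suff: S == - S by rewrite -addr_eq0 -mulr2n mulrn_eq0.
rewrite {1}/S (reindex_inj rev_ord_inj) -sumrN /=.
apply/eqP/eq_bigr => i _; have lt_in := ltn_ord i.
rewrite -mulrN; congr (_ * _).
  rewrite /narayana_num /= -subSn // subSS (bin_sub (ltnW lt_in)).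
  by rewrite bin_sub // mulrAC.
rewrite -[LHS]signr_odd -[in RHS]signr_odd oddB // (negbTE n_even) /=.
by case: (odd i); rewrite ?expr0 ?expr1 ?opprK.
Qed.

End Defs.

(* Main.v *)
Require Import Defs.
From mathcomp Require Import all_boot all_order all_algebra.
From mathcomp Require Import reals polyrcf.
From mathcomp Require Import ring lra zify.
Import Order.TTheory GRing.Theory Num.Theory.
Local Open Scope ring_scope.

(** Pascal's rule gives
      [P_n = n N_n - (n-1)(x+1) N_{n-1}],
    so at a zero [z] of [N_n] the value of [(x+1) P_n] is
    [-(n-1)(z+1)^2 N_{n-1}(z)].  The three-term recurrence
      [(n+3) N_{n+2} = (2n+3)(x+1) N_{n+1} - n (x-1)^2 N_n]
    makes the [N_n] a Sturm sequence on the negative axis, so [N_{n-1}]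
    alternates in sign along the zeros of [N_n], and therefore so does
    [(x+1) P_n] away from [-1].  Adding the signs at [0] and [-oo] locates all
    zeros of [(x+1) P_n] between those of [N_n].  When [n] is even, [-1] is a
    zero of [N_n]; deleting it shifts the later indices by one, which absorbs
    the sign change of [z+1]. *)

(** * Real roots from sign alternation *)

Lemma mulr_signs_lt0 (R : realDomainType) (k : nat) (a b : R) :
  0 < (-1) ^+ k * a -> 0 < (-1) ^+ k.+1 * b -> a * b < 0.
Proof.
rewrite exprS -signr_odd; case: (odd k); rewrite ?expr0 ?expr1 => *; nra.
Qed.

(** The polynomial [f(-x)], multiplied by [(-1)] to the degree of [f], is monic, hence at least 1
    far to the right. *)
Lemma monic_sign_minfty (R : realFieldType) (f : {poly R}) (c : R) :
  f \is monic -> exists2 M, M < c & 0 < (-1) ^+ (size f).-1 * f.[M].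
Proof.
move=> /monicP lf; pose q := (-1) ^+ (size f).-1 *: (f \Po - 'X).
have lq : lead_coef q = 1.
  rewrite lead_coefZ lead_coef_comp ?size_polyN ?size_polyX // lf mul1r.
  by rewrite lead_coefN lead_coefX -exprMn mulrNN mul1r expr1n.
have [|x le_q] := @poly_pinfty_gt_lc _ q; first by rewrite lq.
exists (- Num.max x (1 - c)).
  by rewrite ltrNl lt_max; apply/orP; right; rewrite ltrBDr addrC subrr.
have := le_q (Num.max x (1 - c)).
rewrite lq le_max lexx hornerZ horner_comp hornerN hornerX => /(_ isT).
exact: lt_le_trans.
Qed.

(** [f] changes sign between consecutive points of [M, zs, b] with [M] far to the left, so each of
    the [size zs + 1] gaps contains a root, and the degree leaves room for no others. The bound [b]
    also caps the new roots, which lets the lemma be iterated. *)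
Lemma alternating_roots (R : rcfType) (f : {poly R}) (zs : seq R) (b : R) :
  f \is monic -> size f = (size zs).+2 ->
  sorted <%R zs -> all (< b) zs -> 0 < f.[b] ->
  (forall i, (i < size zs)%N -> 0 < (-1) ^+ (size zs + i) * f.[zs`_i]) ->
  exists xs, [/\ size xs = (size zs).+1, sorted <%R xs, all (< b) xs,
    f = \prod_(x <- xs) ('X - x%:P)
    & forall i, (i < size zs)%N -> xs`_i < zs`_i < xs`_i.+1].
Proof.
move=> mon_f size_f zs_sorted /allP zs_b fb zs_sign.
have [M M_lt M_sign] := monic_sign_minfty _ _ (Num.min b zs`_0) mon_f.
rewrite size_f /= in M_sign.
move: M_lt; rewrite lt_min => /andP[M_b M_z].
set s := size zs in size_f zs_sign M_sign *.
pose w := M :: rcons zs b.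
have wS i : (i < s)%N -> w`_i.+1 = zs`_i.
  by move=> lt_is; rewrite /= nth_rcons lt_is.
have wl : w`_s.+1 = b by rewrite /= nth_rcons ltnn eqxx.
(* Prepending [M] shifts indices by one; at the last point [b] the exponent is even. *)
have w_sign i : (i <= s.+1)%N -> 0 < (-1) ^+ (s.+1 + i) * f.[w`_i].
  case: i => [|i]; first by rewrite addn0.
  rewrite ltnS leq_eqVlt => /orP[/eqP->|lt_is].
    by rewrite wl addnn -signr_odd odd_double mul1r.
  by rewrite wS // addSnnS -addSnnS addSn addnS !exprS !mulN1r opprK zs_sign.
have w_lt i : (i <= s)%N -> w`_i < w`_i.+1.
  case: i => [_|i lt_is].
    have [s0|s_gt0] := posnP s; first by rewrite s0 in wl *; rewrite wl.
    by rewrite wS.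
  rewrite wS //; move: lt_is; rewrite leq_eqVlt => /orP[/eqP def_s|lt_is].
    by rewrite def_s wl; apply/zs_b/mem_nth; rewrite -/s -def_s.
  by rewrite wS //; apply: (sortedP 0 zs_sorted).
(* Guarding by [i <= s], with 0 as a junk root beyond, makes the roots a total function of [i]. *)
have root_between i : {x | (i <= s)%N -> (w`_i < x < w`_i.+1) && root f x}.
  have [le_is|lt_si] := leqP i s; last by exists 0.
  have [||x] := @poly_ivtoo _ f w`_i w`_i.+1; first exact/ltW/w_lt.
    apply: (@mulr_signs_lt0 _ (s.+1 + i)); first by apply: w_sign; apply: leqW.
    by rewrite -addnS; apply: w_sign.
  by rewrite in_itv /= => x_in fx; exists x; rewrite x_in.
pose y i := sval (root_between i).
have yP i : (i <= s)%N -> (w`_i < y i < w`_i.+1) && root f (y i).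
  exact: svalP (root_between i).
have xs_sorted : sorted <%R (mkseq y s.+1).
  apply/(sortedP 0) => i; rewrite size_mkseq => lt_is.
  rewrite !nth_mkseq ?(ltnW lt_is) //.
  have /andP[/andP[_ y1] _] := yP i (ltnW lt_is).
  have /andP[/andP[y2 _] _] := yP i.+1 lt_is.
  exact: lt_trans y2.
exists (mkseq y s.+1); split=> //.
- by rewrite size_mkseq.
- apply/(all_nthP 0) => i; rewrite size_mkseq => lt_is; rewrite nth_mkseq //.
  have /andP[/andP[_ y1] _] := yP i lt_is.
  apply: lt_le_trans y1 _.
  move: lt_is; rewrite ltnS leq_eqVlt => /orP[/eqP->|lt_is]; first by rewrite wl.
  by rewrite wS //; apply/ltW/zs_b/mem_nth.
- rewrite -[RHS]scale1r -(monicP mon_f).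
  apply: all_roots_prod_XsubC; first by rewrite size_mkseq.
  + apply/(all_nthP 0) => i; rewrite size_mkseq => lt_is; rewrite nth_mkseq //.
    by have /andP[] := yP i lt_is.
  + by rewrite uniq_rootsE; apply: lt_sorted_uniq.
- move=> i lt_is; rewrite !nth_mkseq ?ltnS ?(ltnW lt_is) // -(wS i lt_is).
  have /andP[/andP[_ ->] _] := yP i (ltnW lt_is).
  by have /andP[/andP[-> _] _] := yP i.+1 lt_is.
Qed.

(** Exactly [size zs - i] of the factors [y - z] are negative. *)
Lemma prod_XsubC_sign (R : realDomainType) (zs : seq R) (y : R) (i : nat) :
  (i <= size zs)%N ->
  (forall k, (k < i)%N -> zs`_k < y) ->
  (forall k, (i <= k < size zs)%N -> y < zs`_k) ->
  0 < (-1) ^+ (size zs - i) * (\prod_(z <- zs) ('X - z%:P)).[y].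
Proof.
elim: zs i => [|z zs IHzs] i le_i lt_y gt_y; first by rewrite big_nil hornerC mulr1.
rewrite big_cons hornerM hornerXsubC; case: i => [|i] in le_i lt_y gt_y *.
  rewrite subn0 exprS mulrACA mulN1r opprB mulr_gt0 //.
    by rewrite subr_gt0 (gt_y 0).
  by have := IHzs 0; rewrite subn0; apply=> // k; exact: (gt_y k.+1).
rewrite subSS mulrCA mulr_gt0 //; first by rewrite subr_gt0 (lt_y 0).
by apply: IHzs => // k; [exact: (lt_y k.+1) | exact: (gt_y k.+1)].
Qed.

Lemma simple_real_zeros_prod_XsubC (R : realType) (xs : seq R) :
  sorted <%R xs -> simple_real_zeros (\prod_(x <- xs) ('X - x%:P)) xs.
Proof.
by split=> //; rewrite (monicP (monic_prod_XsubC _ _ _)) scale1r.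
Qed.

Lemma prec_of_alternating (R : realType) (f : {poly R}) (zs : seq R) (b : R) :
  f \is monic -> size f = (size zs).+2 ->
  sorted <%R zs -> all (< b) zs -> 0 < f.[b] ->
  (forall i, (i < size zs)%N -> 0 < (-1) ^+ (size zs + i) * f.[zs`_i]) ->
  prec f (\prod_(z <- zs) ('X - z%:P)).
Proof.
move=> mon_f size_f zs_sorted zs_b fb zs_sign.
have [xs [_ xs_sorted _ def_f xz]] :=
  alternating_roots _ _ _ _ mon_f size_f zs_sorted zs_b fb zs_sign.
exists (size zs).+1, xs, zs; split=> //; first by rewrite size_prod_XsubC.
  by rewrite def_f; apply: simple_real_zeros_prod_XsubC.
exact: simple_real_zeros_prod_XsubC.
Qed.

(** * Coefficients of the Narayana polynomials and their recurrence *)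

Lemma coef_narayana_poly (R : realType) (n j : nat) :
  (narayana_poly R n)`_j = narayana_num R n j.+1.
Proof.
rewrite coef_poly; case: ltnP => // le_nj.
by rewrite /narayana_num bin_small ?ltnS // mulr0 mul0r.
Qed.

(** The case [n = 0] is excluded because [d_coef 0 0] is 1 while the polynomial is 0. *)
Lemma coef_P_poly (R : realType) (n j : nat) :
  (0 < n)%N -> (P_poly R n)`_j = (d_coef n j)%:R.
Proof.
case: n => // n _; rewrite coef_poly; case: ltnP => // lt_nj.
by rewrite /d_coef -PoszD addn1 /= !bin_small // ltnW.
Qed.

Lemma narayana_poly1 (R : realType) : narayana_poly R 1 = 1.
Proof.
apply/polyP => j; rewrite coef_narayana_poly coef1 /narayana_num.
case: j => [|j]; first by rewrite bin0 binn invr1 !mulr1.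
by rewrite bin_small // mulr0 mul0r.
Qed.

Lemma size_narayana_poly (R : realType) (n : nat) : size (narayana_poly R n) = n.
Proof.
case: n => [|n]; first by rewrite /narayana_poly poly_def big_ord0 size_poly0.
apply: size_poly_eq; rewrite /narayana_num binn /= binSn mulr1 mulVf ?oner_neq0 //.
by rewrite pnatr_eq0.
Qed.

Lemma monic_narayana_poly (R : realType) (n : nat) :
  (0 < n)%N -> narayana_poly R n \is monic.
Proof.
case: n => // n _; rewrite monicE lead_coefE size_narayana_poly coef_narayana_poly.
by rewrite /narayana_num binn /= binSn mulr1 mulVf // pnatr_eq0.
Qed.

Lemma horner0_narayana_poly (R : realType) (n : nat) :
  (0 < n)%N -> (narayana_poly R n).[0] = 1.
Proof.
case: n => // n _; rewrite horner_coef0 coef_narayana_poly /narayana_num.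
by rewrite bin0 bin1 mulr1 mulVf // pnatr_eq0.
Qed.

Lemma mulr_narayana_num (R : realType) (n j : nat) :
  n%:R * narayana_num R n j.+1 = 'C(n, j)%:R * 'C(n, j.+1)%:R.
Proof.
case: n => [|n]; first by rewrite (@bin_small 0 j.+1) // mul0r mulr0.
by rewrite /narayana_num /= !mulrA mulfV ?pnatr_eq0 // mul1r mulrC.
Qed.

Lemma binz_pred (m j : nat) : binz m (j.+1%:Z - 1) = 'C(m, j).
Proof. by have -> : j.+1%:Z - 1 = j by lia. Qed.

Lemma binz_succ (m j : nat) : binz m (j%:Z + 1) = 'C(m, j.+1).
Proof. by rewrite -PoszD addn1. Qed.

(** With [a], [b], [c] the binomials of [n - 1] over [j - 1], [j], [j + 1], the coefficient of [x^j]
    on the right is [(a + b)(b + c) - (ab + bc) = b^2 + ac]. *)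
Lemma P_poly_narayana (R : realType) (n : nat) : (0 < n)%N ->
  P_poly R n = n%:R *: narayana_poly R n
             - n.-1%:R *: (('X + 1) * narayana_poly R n.-1).
Proof.
case: n => // n _; apply/polyP => j; rewrite coef_P_poly // -pred_Sn.
rewrite coefB !coefZ mulrDl mul1r coefD coefXM !coef_narayana_poly.
rewrite /d_coef binz_succ mulrDr !mulr_narayana_num natrD natrM natrX.
case: j => [|j]; first by rewrite /= !bin0 !bin1 -natr1; ring.
by rewrite binz_pred /= mulr_narayana_num !binS !natrD; ring.
Qed.

(* [p], [a], [b], [c] are the binomials of [n] over [j-2], [j-1], [j], [j+1];
   the matches give [0] where truncated subtraction would give ['C(n, 0)].
   This is the coefficient of [x^j] in [narayana_poly_rec]. *)
Lemma narayana_binomial_identity (R : numFieldType) (n j : nat)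
  (p := if j is j'.+2 then 'C(n, j')%:R else 0 : R)
  (a := if j is j'.+1 then 'C(n, j')%:R else 0 : R)
  (b := 'C(n, j)%:R : R) (c := 'C(n, j.+1)%:R : R) :
  (n%:R + 3) / (n%:R + 2) * (p + 2 * a + b) * (a + 2 * b + c) =
  (2 * n%:R + 3) / (n%:R + 1) * (a + b) * (p + a + b + c)
  - (b * c - 2 * a * b + p * a).
Proof.
have n1 : n%:R + 1 != 0 :> R by rewrite natr1 pnatr_eq0.
have n2 : n%:R + 2 != 0 :> R by rewrite -natrD addn2 pnatr_eq0.
have [le_jn|] := leqP j n.
  (* For [j <= n] the other three binomials are rational multiples of [b]. The factors [j] and
     [j - 1] agree with the zero branches of the matches. *)
  have ec : c = (n - j)%:R * b / j.+1%:R.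
    by apply/(canRL (mulfK _)); rewrite ?pnatr_eq0 // mulrC -!natrM mul_bin_left.
  have ea : a = j%:R * b / (n - j).+1%:R.
    rewrite /a /b; case: j le_jn {p a b c ec} => [|j] le_jn.
      by rewrite !mul0r.
    apply/(canRL (mulfK _)); rewrite ?pnatr_eq0 // -!natrM mul_bin_left.
    by rewrite mulnC -subSn.
  have ep : p = (j%:R - 1) * a / (n - j).+2%:R.
    rewrite /p /a; case: j le_jn {p a b c ec ea} => [|[|j]] le_jn;
      rewrite ?mulr0 ?subrr ?mul0r //.
    apply/(canRL (mulfK _)); rewrite ?pnatr_eq0 //.
    rewrite -(natr1 j.+1) addrK -!natrM mul_bin_left.
    by rewrite (_ : (n - j.+2).+2 = n - j)%N 1?mulnC //; lia.
  rewrite ep ec ea {ep ec ea}; move: n1 n2.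
  (* Writing [n = k + j] leaves a rational identity in the independent variables [k], [j], [b]. *)
  have -> : n%:R = (n - j)%:R + j%:R :> R by rewrite -natrD subnK.
  move: (n - j)%N b => k b n1 n2.
  rewrite -!natr1; field.
  by rewrite ?natr1 n1 n2 !pnatr_eq0.
rewrite leq_eqVlt => /orP[/eqP def_j|].
  rewrite /p /a /b /c -def_j /= (@bin_small n n.+1) // (@bin_small n n.+2) // binn.
  case: n n1 n2 {p a b c def_j} => [|n] n1 n2; first by field.
  by rewrite binSn; move: n.+1%:R n1 n2 => x x1 x2; field; rewrite x1 x2.
(* For [j > n + 1] only [p] can be nonzero, and each product has a factor formed from [a], [b], [c]
   alone. *)
case: j @p @a @b @c => [|[|j]] p a b c // lt_nj.
rewrite /a /b /c (@bin_small n j.+1) // (@bin_small n j.+2) ?(@bin_small n j.+3) //.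
- by ring.
- by rewrite ltnW // ltnW.
- by rewrite ltnW.
Qed.

Lemma narayana_poly_rec (R : realType) (n : nat) :
  (n + 3)%:R *: narayana_poly R n.+2 =
    (2 * n + 3)%:R *: (('X + 1) * narayana_poly R n.+1)
    - n%:R *: (('X - 1) ^+ 2 * narayana_poly R n).
Proof.
have n1 : n%:R + 1 != 0 :> R by rewrite natr1 pnatr_eq0.
have n2 : n%:R + 2 != 0 :> R by rewrite -natrD addn2 pnatr_eq0.
have expand : ('X - 1) ^+ 2 * narayana_poly R n =
    narayana_poly R n - 2 *: (narayana_poly R n * 'X) + narayana_poly R n * 'X^2.
  by rewrite scaler_nat; ring.
(* The recurrence carries the factor [n] on [narayana_poly R n], so [c0] needs no division and
   covers [n = 0]. *)
have c0 := mulr_narayana_num R n.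
have c1 j : narayana_num R n.+1 j.+1 =
    'C(n.+1, j)%:R * 'C(n.+1, j.+1)%:R / (n%:R + 1).
  by rewrite -mulr_narayana_num mulrC -natr1 mulKf.
have c2 j : narayana_num R n.+2 j.+1 =
    'C(n.+2, j)%:R * 'C(n.+2, j.+1)%:R / (n%:R + 2).
  by rewrite -mulr_narayana_num -addn2 mulrC natrD mulKf.
apply/polyP => j.
rewrite expand {expand} mulrDl mul1r.
rewrite coefB !coefZ !coefD coefN coefZ coefXM coefMX coefMXn !coef_narayana_poly.
rewrite !mulrDr mulrN c0.
have := narayana_binomial_identity R n j.
by case: j => [|[|j]] /=;
  rewrite ?subSS ?subn0 ?coef_narayana_poly ?(mulrCA n%:R 2) ?c0 ?c1 ?c2 => id;
  (apply: etrans _ (etrans id _); rewrite ?binS ?bin0 ?bin1 ?natrD ?natrM; field;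
   rewrite ?n1 ?n2).
Qed.

(** * The Narayana polynomials as a Sturm sequence *)

(** At a zero of one polynomial the recurrence gives its two neighbours opposite signs, so the
    alternation of the lower one passes to the higher one. Its value 1 at 0 then supplies the last
    sign change and keeps all zeros negative. *)
Lemma narayana_poly_interlacing (R : realType) (n : nat) :
  exists zs, [/\ size zs = n.+1, sorted <%R zs, all (< 0) zs,
    narayana_poly R n.+2 = \prod_(z <- zs) ('X - z%:P)
    & forall i, (i < n.+1)%N ->
        0 < (-1) ^+ (n + i) * (narayana_poly R n.+1).[zs`_i]].
Proof.
elim: n => [|n [zs [size_zs zs_sorted zs_neg def_N zs_sign]]].
  exists [:: -1]; split=> //=; first by rewrite ltrN10.
    have := narayana_poly_rec R 0.
    rewrite narayana_poly1 scale0r subr0 mulr1 => /(scalerI _) -> //.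
      by rewrite big_seq1 polyCN opprK.
    by rewrite pnatr_eq0.
  by case=> // _; rewrite narayana_poly1 hornerC mulr1.
have n4 : 0 < (n.+1 + 3)%:R :> R by rewrite ltr0n.
have [||i lt_i|xs [size_xs xs_sorted xs_neg def_N3 xz]] :=
  @alternating_roots R (narayana_poly R n.+3) zs 0 (monic_narayana_poly R n.+3 isT)
    _ zs_sorted zs_neg.
- by rewrite size_narayana_poly size_zs.
- by rewrite horner0_narayana_poly.
- rewrite size_zs in lt_i *.
  have z_root : (narayana_poly R n.+2).[zs`_i] = 0.
    by apply/eqP; rewrite def_N -/(root _ _) root_prod_XsubC mem_nth ?size_zs.
  have rec_z : (n.+1 + 3)%:R * (narayana_poly R n.+3).[zs`_i] =
      - (n.+1%:R * (zs`_i - 1) ^+ 2 * (narayana_poly R n.+1).[zs`_i]).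
    have := congr1 (horner^~ zs`_i) (narayana_poly_rec R n.+1).
    by rewrite /= !hornerE /= z_root => ->; ring.
  have z_lt0 : zs`_i < 0 by apply: (allP zs_neg); rewrite mem_nth ?size_zs.
  have coef_gt0 : 0 < n.+1%:R * (zs`_i - 1) ^+ 2.
    rewrite mulr_gt0 ?ltr0n // exprn_even_gt0 //=.
    by rewrite subr_eq0 lt_eqF // (lt_trans z_lt0).
  rewrite -(pmulr_rgt0 _ n4) mulrCA rec_z mulrN addSn exprS mulN1r mulNr opprK.
  by rewrite mulrCA pmulr_rgt0 //; apply: zs_sign.
exists xs; rewrite size_xs size_zs; split=> // i le_i.
have xz' k : (k < n.+1)%N -> xs`_k < zs`_k < xs`_k.+1.
  by rewrite -size_zs; apply: xz.
have le_xs := lt_sorted_leq_nth 0 xs_sorted.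
have -> : (-1) ^+ (n.+1 + i) = (-1) ^+ (size zs - i) :> R.
  by rewrite size_zs -signr_odd -[RHS]signr_odd oddD oddB.
rewrite def_N; apply: prod_XsubC_sign; first by rewrite size_zs.
- move=> k lt_ki; have /andP[_ z_lt] := xz' k (leq_trans lt_ki le_i).
  apply: lt_le_trans z_lt _; rewrite le_xs ?inE ?size_xs ?size_zs //.
  by rewrite ltnS (leq_trans lt_ki).
- rewrite size_zs => k /andP[le_ik lt_k]; have /andP[lt_z _] := xz' k lt_k.
  apply: le_lt_trans lt_z; rewrite le_xs ?inE ?size_xs ?size_zs //.
  exact: leqW.
Qed.

(** * Signs of [P_n] at the zeros of [N_n], and the two interlacings *)

Lemma horner_P_poly_root (R : realType) (n : nat) (z : R) :
  root (narayana_poly R n.+2) z ->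
  (P_poly R n.+2).[z] = - (n.+1%:R * (z + 1) * (narayana_poly R n.+1).[z]).
Proof.
move=> /eqP z_root; rewrite P_poly_narayana // -pred_Sn.
by rewrite !hornerE /= z_root; ring.
Qed.

Lemma d_coef_last (n : nat) : d_coef n.+1 n = 1%N.
Proof. by rewrite /d_coef binz_succ /= binn bin_small. Qed.

Lemma size_P_poly (R : realType) (n : nat) : size (P_poly R n) = n.
Proof.
case: n => [|n]; first by rewrite /P_poly poly_def big_ord0 size_poly0.
by apply: size_poly_eq; rewrite d_coef_last oner_neq0.
Qed.

Lemma monic_P_poly (R : realType) (n : nat) : (0 < n)%N -> P_poly R n \is monic.
Proof.
case: n => // n _; rewrite monicE lead_coefE size_P_poly coef_P_poly //.
by rewrite d_coef_last.
Qed.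

Lemma horner0_P_poly (R : realType) (n : nat) : (0 < n)%N -> (P_poly R n).[0] = 1.
Proof.
by move=> n_gt0; rewrite horner_coef0 coef_P_poly // /d_coef /= bin0 muln0.
Qed.

(** At -1 the middle term of the recurrence vanishes, so values two indices apart differ by a
    nonzero factor, starting from [N_1 = 1]. *)
Lemma narayana_poly_odd_neq0 (R : realType) (n : nat) :
  odd n -> (narayana_poly R n).[-1] != 0.
Proof.
move=> n_odd; rewrite -(odd_double_half n) n_odd add1n.
elim: n./2 => [|k IHk]; first by rewrite narayana_poly1 hornerC oner_neq0.
have := congr1 (horner^~ (-1)) (narayana_poly_rec R k.*2.+1).
rewrite /= !hornerE /= addNr mulr0 mul0r sub0r => rec.
rewrite doubleS; apply: contra_neq IHk => N0; move/eqP: rec.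
rewrite N0 mulr0 eq_sym oppr_eq0 !mulf_eq0 pnatr_eq0 /= => /orP[|/eqP //].
by rewrite orbb lt_eqF //; lra.
Qed.

Theorem corollary3p4 (R : realType) :
  (forall n : nat, (3 <= n)%N -> odd n ->
     prec (('X + 1) * P_poly R n) (narayana_poly R n)) /\
  (forall n : nat, (2 <= n)%N -> ~~ odd n ->
     prec (P_poly R n) (narayana_poly R n %/ ('X + 1))).
Proof.
have X1 : 'X + 1 = 'X - (-1)%:P :> {poly R} by rewrite polyCN opprK.
split=> [[|[|n]] // _ n_odd|[|[|n]] // _ n_even];
  have [zs [size_zs zs_sorted zs_neg def_N zs_sign]] :=
    narayana_poly_interlacing R n.
  rewrite [X in prec _ X]def_N; apply: (prec_of_alternating _ _ _ 0) => //.
  - by rewrite X1 monicMl ?monicXsubC ?monic_P_poly.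
  - rewrite X1 size_Mmonic ?monic_P_poly ?polyXsubC_eq0 //.
    by rewrite size_XsubC size_P_poly size_zs.
  - by rewrite !hornerE horner0_P_poly // mulr1 ltr01.
  move=> i; rewrite size_zs => lt_i.
  have z_root : root (narayana_poly R n.+2) zs`_i.
    by rewrite def_N root_prod_XsubC mem_nth ?size_zs.
  have z1 : zs`_i + 1 != 0.
    apply: contraTneq z_root => /eqP; rewrite addr_eq0 => /eqP ->.
    exact: narayana_poly_odd_neq0.
  have coef_gt0 : 0 < n.+1%:R * (zs`_i + 1) ^+ 2.
    by rewrite mulr_gt0 ?ltr0n // exprn_even_gt0.
  have -> : (('X + 1) * P_poly R n.+2).[zs`_i] =
      - (n.+1%:R * (zs`_i + 1) ^+ 2 * (narayana_poly R n.+1).[zs`_i]).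
    by rewrite hornerM horner_P_poly_root // !hornerE /=; ring.
  (* The list has length [n + 1], one more than the [n] in the exponent of [zs_sign]; this cancels
     the minus sign. *)
  rewrite mulrN addSn exprS mulN1r mulNr opprK mulrCA pmulr_rgt0 //.
  exact: zs_sign.
have m1_zs : -1 \in zs.
  by rewrite -root_prod_XsubC -def_N -dvdp_XsubCl -X1 dvdp_narayana_poly.
have : forall z, z \in zs -> root (narayana_poly R n.+2) z.
  by move=> z z_in; rewrite def_N root_prod_XsubC.
case/splitPr: m1_zs => ys1 ys2 in size_zs zs_sorted zs_neg def_N zs_sign *.
move=> zs_root.
rewrite def_N big_cat big_cons /= -X1 mulrCA mulrC mulpK; last first.
  by rewrite X1 polyXsubC_eq0.
rewrite -big_cat /=.
have size_ys : (size ys1 + size ys2)%N = n.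
  by apply/eqP; rewrite -eqSS -addnS -size_zs size_cat.
move: zs_sorted; rewrite lt_sorted_pairwise pairwise_cat /=.
move=> /and3P[ys12 ys1_sorted /andP[ys2_gt ys2_sorted]].
move: ys12; rewrite allrel_consr => /andP[ys1_lt ys12].
have ys_root z : z \in ys1 ++ ys2 -> root (narayana_poly R n.+2) z.
  move=> z_in; apply: zs_root; move: z_in.
  by rewrite !mem_cat inE => /orP[] ->; rewrite ?orbT.
have n1 : 0 < n.+1%:R :> R by rewrite ltr0n.
apply: (prec_of_alternating _ _ _ 0).
- exact: monic_P_poly.
- by rewrite size_P_poly size_cat size_ys.
- by rewrite lt_sorted_pairwise pairwise_cat ys12 ys1_sorted ys2_sorted.
- by move: zs_neg; rewrite !all_cat /= => /and3P[-> _ ->].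
- by rewrite horner0_P_poly.
move=> i lt_i; rewrite horner_P_poly_root; last exact/ys_root/mem_nth.
move: lt_i; rewrite size_cat size_ys => lt_i.
rewrite (_ : _ * - _ = n.+1%:R *
  ((-1) ^+ (n + i) * (narayana_poly R n.+1).[(ys1 ++ ys2)`_i]
   * - ((ys1 ++ ys2)`_i + 1))); last by ring.
(* Zeros below -1 keep their index in the original list and have [-(z + 1) > 0]. Those above had
   index [i + 1] there, and the extra sign offsets [-(z + 1) < 0]. *)
rewrite pmulr_rgt0 // nth_cat; case: ltnP => [lt_i1|le_i1].
  have z_lt : ys1`_i < -1 by apply: (allP ys1_lt); rewrite mem_nth.
  have := zs_sign i (leqW lt_i); rewrite nth_cat lt_i1 => sN.
  by rewrite mulr_gt0 //; lra.
have lt_i2 : (i - size ys1 < size ys2)%N by rewrite ltn_subLR // size_ys.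
have z_gt : -1 < ys2`_(i - size ys1) by apply: (allP ys2_gt); rewrite mem_nth.
have := zs_sign i.+1 lt_i; rewrite nth_cat ltnNge leqW //= subSn //= => sN.
rewrite mulrN -mulNr mulr_gt0 //; last by lra.
by move: sN; rewrite addnS exprS mulN1r mulNr.
Qed.
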